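(* Let $F:\mathbb{R}^d\to\mathbb{R}$ be a convex differentiable function with a (possibly non-unique) minimizer $x^*$, and let $\alpha\in(\frac12,1)$. Suppose that for all $t\ge1$, $\mathbb{E}[g_t\mid\mathcal{F}_t]=\nabla F(x_t)$ and $\|g_t\|\le G$ almost surely. Then Algorithm 1 with initial point $x_0\in\mathbb{R}^d$ and learning rates $\eta_t=\frac{1}{Gt^\alpha}$ satisfies, for all $T\ge1$, $$\mathbb{E}[F(\bar x_T)]\le F(x^* )+\frac{G}{T^{1-\alpha}}\Big(1+S\,\|x^*-x_0\|\big[2\ln(1+2\|x^*-x_0\|)+9S\big]\Big),$$ where $S=\sqrt{5+\frac{1}{2\alpha-1}}$ and $\bar x_T=\frac1T\sum_{t=1}^T x_t$.
   Context: $\|\cdot\|$ is the Euclidean norm on $\mathbb{R}^d$, $G>0$. Setting: an algorithm outputs iterates $x_1,x_2,\dots$; after outputting $x_t$ it receives a random vector $g_t\in\mathbb{R}^d$ (stochastic gradient). $\mathcal{F}_t$ is the $\sigma$-algebra generated by $x_1,\dots,x_t,g_1,\dots,g_{t-1}$. Auxiliary functions: for $\theta\in\mathbb{R}$, $S>0$, $Q\ge0$, $\psi^*(\theta,S,Q)=\exp\big(\max_{\beta\in[-1/2,1/2]}(\theta\beta-\beta^2S^2)-Q\big)$, which equals $\exp(\theta^2/(4S^2)-Q)$ if $|\theta|\le S^2$ and $\exp(|\theta|/2-S^2/4-Q)$ if $|\theta|>S^2$; and $\psi(x,S,Q)=\sup_{\theta\in\mathbb{R}}(\theta x-\psi^*(\theta,S,Q))$.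 Algorithm 1 (input: $x_0\in\mathbb{R}^d$ and learning rates $\eta_1,\eta_2,\dots$): set $S_0^2=4$, $Q_0=0$, $\theta_0=0\in\mathbb{R}^d$. For $t=1,2,\dots$: output $x_t=x_0+\frac{\theta_{t-1}}{2S_{t-1}^2}\exp\big(\frac{\|\theta_{t-1}\|^2}{4S_{t-1}^2}-Q_{t-1}\big)$ if $\|\theta_{t-1}\|\le S_{t-1}^2$, and $x_t=x_0+\frac{\theta_{t-1}}{2\|\theta_{t-1}\|}\exp\big(\frac{\|\theta_{t-1}\|}{2}-\frac{S_{t-1}^2}{4}-Q_{t-1}\big)$ otherwise (equivalently, $x_t-x_0$ is the unique minimizer of $x\mapsto \psi(\|x\|,S_{t-1},Q_{t-1})-\langle\theta_{t-1},x\rangle$); receive $g_t$; set $\ell_t=\eta_tg_t$, $S_t^2=S_{t-1}^2+\|\ell_t\|^2$ ($S_t>0$), $Q_t=Q_{t-1}+\|\ell_t\|^2/S_t^2$, $\theta_t=\theta_{t-1}-\ell_t$. *)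

(* Defs.v *)
From HB Require Import structures.
From mathcomp Require Import all_boot all_order all_algebra.
From mathcomp Require Import all_classical all_reals all_analysis.
Set Implicit Arguments. Unset Strict Implicit. Unset Printing Implicit Defensive.
Import Order.TTheory GRing.Theory Num.Theory.
Import numFieldNormedType.Exports.
Local Open Scope classical_set_scope.
Local Open Scope ring_scope.

Section Defs.
Variables (R : realType) (d : nat).
Notation vec := 'rV[R]_d.

(* Euclidean norm on R^d (the library norm on matrices is the max norm). *)
Definition enorm (v : vec) : R := Num.sqrt (\sum_(i < d) (v ord0 i) ^+ 2).

Definition dotp (u v : vec) : R := \sum_(i < d) u ord0 i * v ord0 i.

Definition basis_vec (i : 'I_d) : vec := delta_mx ord0 i.

Definition grad (F : vec -> R) (x : vec) : vec :=
  \row_(i < d) ('D_(basis_vec i) F x).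

Definition convex_fun (F : vec -> R) : Prop :=
  forall (x y : vec) (l : R), 0 <= l <= 1 ->
    F ((1 - l) *: x + l *: y) <= (1 - l) * F x + l * F y.

(* State of Algorithm 1 after t updates: (S_t^2, Q_t, theta_t). *)
Record alg_state := AlgState { st_S2 : R; st_Q : R; st_theta : vec }.

Definition alg_init : alg_state := AlgState 4 0 0.

Definition alg_update (s : alg_state) (l : vec) : alg_state :=
  let S2' := st_S2 s + enorm l ^+ 2 in
  AlgState S2' (st_Q s + enorm l ^+ 2 / S2') (st_theta s - l).

(* eta t = learning rate eta_t, g t = stochastic gradient g_t (for t >= 1;
   index 0 is unused). *)
Fixpoint alg_state_at (eta : nat -> R) (g : nat -> vec) (t : nat) : alg_state :=
  match t with
  | 0 => alg_init
  | t'.+1 => alg_update (alg_state_at eta g t') (eta t'.+1 *: g t'.+1)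
  end.

Definition alg_output (x0 : vec) (s : alg_state) : vec :=
  let th := st_theta s in let S2 := st_S2 s in let Q := st_Q s in
  if enorm th <= S2 then
    x0 + (expR (enorm th ^+ 2 / (4 * S2) - Q) / (2 * S2)) *: th
  else
    x0 + (expR (enorm th / 2 - S2 / 4 - Q) / (2 * enorm th)) *: th.

Definition alg_x (x0 : vec) (eta : nat -> R) (g : nat -> vec) (t : nat) : vec :=
  alg_output x0 (alg_state_at eta g t.-1).

Definition alg_xbar (x0 : vec) (eta : nat -> R) (g : nat -> vec) (T : nat) : vec :=
  T%:R^-1 *: \sum_(1 <= t < T.+1) alg_x x0 eta g t.

End Defs.

Section Filtration.
Context {R : realType} {d : nat} {dO : measure_display} {Omega : measurableType dO}.

(* Generators of F_t = sigma(x_1,...,x_t, g_1,...,g_{t-1}): preimages of Borel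
   sets of R under the coordinates of these random vectors. *)
Definition filt_gen (x g : nat -> Omega -> 'rV[R]_d) (t : nat) : set (set Omega) :=
  [set A | exists (i : 'I_d) (B : set R), measurable B /\
     ((exists s, (1 <= s <= t)%N /\ A = (fun w => x s w ord0 i) @^-1` B) \/
      (exists s, (1 <= s < t)%N /\ A = (fun w => g s w ord0 i) @^-1` B))].

Definition filt (x g : nat -> Omega -> 'rV[R]_d) (t : nat) : set (set Omega) :=
  <<s filt_gen x g t >>.

Definition is_cond_exp (P : probability Omega R) (Fs : set (set Omega))
  (X Y : Omega -> 'rV[R]_d) : Prop :=
  forall i : 'I_d,
    P.-integrable setT (fun w => (X w ord0 i)%:E) /\
    P.-integrable setT (fun w => (Y w ord0 i)%:E) /\
    forall A, Fs A ->
      (\int[P]_(w in A) (X w ord0 i)%:E = \int[P]_(w in A) (Y w ord0 i)%:E)%E.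
End Filtration.

(* Main.v *)
(* Write x_t - x0 = Phi_{t-1} b_{t-1}, where Phi = exp (max_{|b| <= 1/2} (<theta, b> - S^2 |b|^2) - Q)
   is the dual potential and b the maximizer. Strong concavity of the maximum and
   exp (-z - z^2) <= 1 - z for |z| <= 1/2 give Phi_t <= Phi_{t-1} - <l_t, x_t - x0>, so
   the regret of the losses l_t = eta_t g_t against u is at most
   1 + <theta_T, u - x0> - Phi_T. Testing the maximum in Phi_T at b = (u - x0) / (S |u - x0|) bounds
   this by Fenchel-Young for exp, with S_T^2 <= 4 + sum t^(-2 alpha) <= S^2 and
   Q_T <= ln S_T^2. Since eta is decreasing and F(x_t) >= F(xstar), convexity gives
   T eta_T (F(xbar) - F(xstar)) <= sum_t eta_t <grad F(x_t), x_t - xstar>, and in expectation grad F(x_t) may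
   be replaced by g_t because x_t is F_t-measurable and almost surely bounded. *)
Require Import Defs.
From HB Require Import structures.
From mathcomp Require Import all_boot all_order all_algebra.
From mathcomp Require Import all_classical all_reals all_analysis.
From mathcomp Require Import measurable_realfun.
From mathcomp Require Import ring lra.
Import Order.TTheory GRing.Theory Num.Theory.
Import numFieldNormedType.Exports.
Local Open Scope classical_set_scope.
Local Open Scope ring_scope.

(** * Euclidean inner product, norm and Cauchy-Schwarz *)

Section EuclideanGeometry.
Context {R : realType} {d : nat}.
Implicit Types (u v w : 'rV[R]_d) (a : R).

Lemma dotpC u v : dotp u v = dotp v u.
Proof. by apply: eq_bigr => i _; rewrite mulrC. Qed.

Lemma dotpDl u v w : dotp (u + v) w = dotp u w + dotp v w.
Proof. by rewrite /dotp -big_split; apply: eq_bigr => i _; rewrite mxE mulrDl. Qed.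

Lemma dotpZl a u v : dotp (a *: u) v = a * dotp u v.
Proof. by rewrite /dotp mulr_sumr; apply: eq_bigr => i _; rewrite mxE mulrA. Qed.

Lemma dotpBl u v w : dotp (u - v) w = dotp u w - dotp v w.
Proof. by rewrite dotpDl -scaleN1r dotpZl mulN1r. Qed.

Lemma dotpDr u v w : dotp u (v + w) = dotp u v + dotp u w.
Proof. by rewrite dotpC dotpDl !(dotpC u). Qed.

Lemma dotpZr a u v : dotp u (a *: v) = a * dotp u v.
Proof. by rewrite dotpC dotpZl (dotpC u). Qed.

Lemma dotpBr u v w : dotp u (v - w) = dotp u v - dotp u w.
Proof. by rewrite dotpC dotpBl !(dotpC u). Qed.

Lemma dotpNl u v : dotp (- u) v = - dotp u v.
Proof. by rewrite -scaleN1r dotpZl mulN1r. Qed.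

Lemma dotpNr u v : dotp u (- v) = - dotp u v.
Proof. by rewrite dotpC dotpNl (dotpC u). Qed.

Definition dotpE := (dotpDl, dotpDr, dotpNl, dotpNr, dotpZl, dotpZr).

Lemma dotp0l u : dotp 0 u = 0.
Proof. by rewrite -(scale0r u) dotpZl mul0r. Qed.

Lemma dotp_suml n (f : nat -> 'rV[R]_d) w :
  dotp (\sum_(1 <= t < n) f t) w = \sum_(1 <= t < n) dotp (f t) w.
Proof. by apply: (big_morph (fun u => dotp u w) (fun u v => dotpDl u v w) (dotp0l w)). Qed.

Lemma dotpp_ge0 u : 0 <= dotp u u.
Proof. by apply: sumr_ge0 => i _; rewrite -expr2 sqr_ge0. Qed.

Lemma dotpp_eq0 u : dotp u u = 0 -> u = 0.
Proof.
move=> /eqP; rewrite psumr_eq0 => [/allP u0|i _]; last by rewrite -expr2 sqr_ge0.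
apply/rowP => i; rewrite mxE; apply/eqP.
by have := u0 i (mem_index_enum i); rewrite /= mulf_eq0 orbb.
Qed.

Lemma enorm_ge0 u : 0 <= enorm u.
Proof. exact: sqrtr_ge0. Qed.

Lemma enorm_sqr u : enorm u ^+ 2 = dotp u u.
Proof.
rewrite sqr_sqrtr; first by apply: eq_bigr => i _; rewrite expr2.
by apply: sumr_ge0 => i _; rewrite sqr_ge0.
Qed.

Lemma enormZ a u : enorm (a *: u) = `|a| * enorm u.
Proof.
rewrite -sqrtr_sqr -sqrtrM ?sqr_ge0//; congr Num.sqrt.
by rewrite mulr_sumr; apply: eq_bigr => i _; rewrite mxE exprMn.
Qed.

Lemma enorm_eq0 u : enorm u = 0 -> u = 0.
Proof. by move=> u0; apply: dotpp_eq0; rewrite -enorm_sqr u0 expr0n. Qed.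

Lemma normr_coord_le_enorm u i : `|u ord0 i| <= enorm u.
Proof.
rewrite -sqrtr_sqr ler_wsqrtr// (bigD1 i)//= lerDl.
by apply: sumr_ge0 => j _; rewrite sqr_ge0.
Qed.

(** The squared norm of [dotp u u *: v - dotp u v *: u] is [dotp u u] times the gap between the two
    sides. *)
Lemma dotp_sqr_le u v : dotp u v ^+ 2 <= dotp u u * dotp v v.
Proof.
have [u0|u0] := eqVneq (dotp u u) 0.
  by rewrite u0 (dotpp_eq0 _ u0) dotp0l expr0n mul0r.
have up : 0 < dotp u u by rewrite lt_def u0 dotpp_ge0.
rewrite -subr_ge0 -(pmulr_rge0 _ up).
have := dotpp_ge0 (dotp u u *: v - dotp u v *: u).
rewrite !dotpE (dotpC v u).
by congr (0 <= _); ring.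
Qed.

Lemma CauchySchwarz_dotp u v : `|dotp u v| <= enorm u * enorm v.
Proof.
rewrite -ler_sqr ?nnegrE ?mulr_ge0 ?enorm_ge0//.
by rewrite exprMn !enorm_sqr real_normK ?num_real// dotp_sqr_le.
Qed.

Lemma dotp_le_enorm u v : dotp u v <= enorm u * enorm v.
Proof. exact: le_trans (ler_norm _) (CauchySchwarz_dotp u v). Qed.

End EuclideanGeometry.

(** For [w >= 0] the bound exp x >= 1 + x at x = w^2 - w suffices, because (1 + w)(1 - w + w^2) = 1
    + w^3 >= 1. For [w < 0] this product drops below 1 and a sharper lower bound on exp (w^2 - w) is
    needed. *)
Lemma expR_quad_le {R : realType} (w : R) : `|w| <= 1 / 2 -> expR (w - w ^+ 2) <= 1 + w.
Proof.
move=> /[!ler_norml] /andP[w1 w2].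
have [w0|w0] := leP 0 w.
  have : 1 + (w ^+ 2 - w) <= expR (w ^+ 2 - w) := expR_ge1Dx _.
  rewrite -(opprB w) expRN; set e := expR _ => h.
  have e0 : 0 < e by exact: expR_gt0.
  have : (1 + - (w - w ^+ 2)) * e <= 1 by rewrite -ler_pdivlMr// mul1r.
  nra.
(* The exponent is cut into eight equal parts: exp (8 y) >= (1 + y)^8, of which the binomial terms
   up to y^3 are kept. Their product with 1 + w exceeds 1 by w^2 / 64 times a polynomial positive on
   [-1/2, 0]. *)
pose y := (w ^+ 2 - w) / 8.
have y0 : 0 <= y by rewrite /y; nra.
have : (1 + y) ^+ 8 <= expR y ^+ 8.
  by apply: lerXn2r (expR_ge1Dx y); rewrite nnegrE ?expR_ge0 ?addr_ge0.
have : 1 + 8 * y + 28 * y ^+ 2 + 56 * y ^+ 3 <= (1 + y) ^+ 8.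
  rewrite -subr_ge0; have -> : (1 + y) ^+ 8 - (1 + 8 * y + 28 * y ^+ 2 + 56 * y ^+ 3) =
    y ^+ 4 * (70 + 56 * y + 28 * y ^+ 2 + 8 * y ^+ 3 + y ^+ 4) by ring.
  apply: mulr_ge0; first exact: exprn_ge0.
  by move: (exprn_ge0 2 y0) (exprn_ge0 3 y0) (exprn_ge0 4 y0); lra.
rewrite -expRM_natl.
have -> : w - w ^+ 2 = - (8%:R * y) by rewrite /y; field.
move=> h1 /(le_trans h1){h1}; rewrite expRN; set e := expR _ => h.
rewrite -[leLHS]mul1r ler_pdivrMr ?expR_gt0//.
apply: le_trans (ler_wpM2l _ h); last by lra.
rewrite /y -subr_ge0.
have -> : (1 + w) * (1 + 8 * ((w ^+ 2 - w) / 8) + 28 * ((w ^+ 2 - w) / 8) ^+ 2 +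
    56 * ((w ^+ 2 - w) / 8) ^+ 3) - 1 =
    w ^+ 2 * (28 + 29 * w - 14 * w ^+ 2 + 28 * w ^+ 3 - 14 * w ^+ 4 + 7 * w ^+ 5) / 64 by field.
apply: divr_ge0 => //; apply: mulr_ge0; first exact: sqr_ge0.
have w_2 : w ^+ 2 <= 1 / 4 by nra.
have w3 : - w ^+ 3 <= 1 / 8 by rewrite exprS; nra.
have w4 : w ^+ 4 <= 1 / 16 by rewrite (exprM w 2 2); nra.
have w5 : - w ^+ 5 <= 1 / 32 by rewrite exprS; nra.
lra.
Qed.

(** * The dual potential and its decrease under one update *)

Section Potential.
Context {R : realType} {d : nat}.
Implicit Types (th b l : 'rV[R]_d) (s : R).

(* The maximizer over the ball |b| <= 1/2 of <th, b> - s |b|^2, so that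
   psi^*(|th|, S, Q) = expR (dual_val th (S^2) - Q). *)
Definition dual_arg th s : 'rV[R]_d :=
  if enorm th <= s then (2 * s)^-1 *: th else (2 * enorm th)^-1 *: th.

Definition dual_val th s : R :=
  dotp th (dual_arg th s) - s * dotp (dual_arg th s) (dual_arg th s).

Lemma dual_arg_sqr_le th s : 0 < s ->
  dotp (dual_arg th s) (dual_arg th s) <= 1 / 4.
Proof.
move=> s0; rewrite /dual_arg; case: ifPn => [ths|]; rewrite !dotpE -enorm_sqr.
  rewrite mulrA -expr2 -exprMn mulrC.
  have -> : 1 / 4 = (1 / 2) ^+ 2 :> R by field.
  apply: lerXn2r; rewrite ?nnegrE ?mulr_ge0 ?enorm_ge0 ?invr_ge0//; try lra.
  by rewrite ler_pdivrMr; lra.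
rewrite -ltNge => sth; have th0 := lt_trans s0 sth.
by rewrite le_eqVlt; apply/orP; left; apply/eqP; field; lra.
Qed.

(** First-order optimality over the ball: the left factor is the gradient of the objective at the
    maximizer. It vanishes in the unconstrained case; otherwise it is a nonnegative multiple of
    [th], and th / (2 |th|) maximizes the inner product with [th]. *)
Lemma dual_arg_optimal th s b : 0 < s -> dotp b b <= 1 / 4 ->
  dotp (th - (2 * s) *: dual_arg th s) (b - dual_arg th s) <= 0.
Proof.
move=> s0 b4; rewrite /dual_arg; case: ifPn => [ths|].
  by rewrite scalerA mulfV ?scale1r ?subrr ?dotp0l//; lra.
rewrite -ltNge => sth; have th0 := lt_trans s0 sth.
have -> : th - 2 * s *: ((2 * enorm th)^-1 *: th) = (1 - s / enorm th) *: th.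
  by rewrite scalerA scalerBl scale1r; congr (_ - _ *: _); field; lra.
rewrite dotpZl mulr_ge0_le0//.
  by rewrite subr_ge0 ler_pdivrMr// mul1r ltW.
rewrite dotpBr dotpZr -enorm_sqr subr_le0.
apply: le_trans (dotp_le_enorm _ _) _.
have -> : (2 * enorm th)^-1 * enorm th ^+ 2 = enorm th * (1 / 2) by field; lra.
rewrite ler_pM2l//.
rewrite -enorm_sqr in b4; have := enorm_ge0 b; nra.
Qed.

(** Expanding the quadratic at [dual_arg th s] leaves a first-order term, nonpositive by optimality,
    and - s |b - dual_arg th s|^2. *)
Lemma dual_val_ge th s b : 0 < s -> dotp b b <= 1 / 4 ->
  dotp th b - s * dotp b b <= dual_val th s.
Proof.
move=> s0 b4; rewrite /dual_val.
have := dual_arg_optimal th s b s0 b4.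
have := mulr_ge0 (ltW s0) (dotpp_ge0 (b - dual_arg th s)).
rewrite !dotpE (dotpC b (dual_arg th s)); set a := dual_arg th s.
lra.
Qed.

(** Stability: by strong concavity, keeping the old maximizer in the new objective loses at most
    |l|^2 / (s + |l|^2), which is the increment of Q. *)
Lemma dual_val_step th l s : 0 < s -> enorm l <= 1 ->
  dual_val (th - l) (s + dotp l l) <=
  dotp (th - l) (dual_arg th s)
    - (s + dotp l l) * dotp (dual_arg th s) (dual_arg th s)
    + dotp l l / (s + dotp l l).
Proof.
move=> s0 l1; set a := dotp l l; set b := dual_arg th s.
have a0 : 0 <= a by exact: dotpp_ge0.
have sa0 : 0 < s + a by lra.
have a1 : a <= 1 by rewrite /a -enorm_sqr expr_le1// enorm_ge0.
have b4 := dual_arg_sqr_le th s s0; have b'4 := dual_arg_sqr_le (th - l) _ sa0.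
have opt := dual_arg_optimal th s _ s0 b'4.
rewrite /dual_val; move: b'4 opt; set b' := dual_arg (th - l) (s + a); rewrite -/b in b4 * => b'4 opt.
(* [- v] is the change of the gradient of the objective at [b] when [th] and [s] become [th - l] and
   [s + a]. Its squared norm is at most 2 a + 8 a^2 |b|^2 <= 4 a. *)
pose v := l + (2 * a) *: b.
have v4 : dotp v v <= 4 * a.
  have := CauchySchwarz_dotp l b; rewrite ler_norml => /andP[_].
  have := dotpp_ge0 (l - (2 * a) *: b).
  by rewrite /v !dotpE (dotpC b l) -/a; nra.
(* completing the square: -<v, b' - b> - s' |b' - b|^2 <= |v|^2 / (4 s') *)
have := dotpp_ge0 (v + (2 * (s + a)) *: (b' - b)).
rewrite -lerBlDl ler_pdivlMr//.
move: opt v4; rewrite /v !dotpE !(dotpC b' _) !(dotpC b l) -/a.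
nra.
Qed.

(** The increment of [Q] cancels the loss in [dual_val_step]. With w = - <l, b>, the term a |b|^2
    coming from the growth of [s] dominates w^2, so the exponent grows by at most w - w^2, and
    [expR_quad_le] turns this into the factor 1 + w. *)
Lemma dual_potential_step th l s Q : 0 < s -> enorm l <= 1 ->
  expR (dual_val (th - l) (s + dotp l l) - (Q + dotp l l / (s + dotp l l))) <=
  expR (dual_val th s - Q) * (1 - dotp l (dual_arg th s)).
Proof.
move=> s0 l1; set a := dotp l l; set b := dual_arg th s.
have b4 := dual_arg_sqr_le th s s0; rewrite -/b in b4.
have lb : dotp l b ^+ 2 <= a * dotp b b by exact: dotp_sqr_le.
have a1 : a <= 1 by rewrite /a -enorm_sqr expr_le1// enorm_ge0.
have a0 : 0 <= a by exact: dotpp_ge0.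
have lb2 : `|- dotp l b| <= 1 / 2.
  rewrite normrN -ler_sqr ?nnegrE//.
  by rewrite real_normK ?num_real//; nra.
apply: le_trans (ler_wpM2l (expR_ge0 _) (expR_quad_le _ lb2)).
rewrite -expRD ler_expR.
have := dual_val_step th l s s0 l1; rewrite -/a -/b dotpBl.
rewrite [dual_val th s]/dual_val -/b; lra.
Qed.

End Potential.

(** * Pathwise regret for arbitrary rates and gradients *)

Section Regret.
Context {R : realType} {d : nat}.
Variables (x0 : 'rV[R]_d) (eta : nat -> R) (g : nat -> 'rV[R]_d).

Let st t := alg_state_at eta g t.
Let l t := eta t *: g t.
Let pot t := expR (dual_val (st_theta (st t)) (st_S2 (st t)) - st_Q (st t)).

Lemma alg_outputE (s : alg_state R d) : 0 < st_S2 s ->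
  alg_output x0 s =
  x0 + expR (dual_val (st_theta s) (st_S2 s) - st_Q s) *: dual_arg (st_theta s) (st_S2 s).
Proof.
case: s => s Q th /= s0; rewrite /alg_output /dual_val /dual_arg /=.
case: ifPn => [_|]; rewrite !dotpE scalerA -!enorm_sqr.
  set B := (_ - s * _); have -> : B = enorm th ^+ 2 / (4 * s) by rewrite /B; field; lra.
  by [].
rewrite -ltNge => sth; have th0 := lt_trans s0 sth.
set B := (_^-1 * _ - s * _); have -> : B = enorm th / 2 - s / 4 by rewrite /B; field; lra.
by [].
Qed.

Lemma st_S2_at t : st_S2 (st t) = 4 + \sum_(1 <= k < t.+1) dotp (l k) (l k).
Proof.
elim: t => [|t IH]; first by rewrite big_geq// addr0.
by rewrite big_nat_recr//= addrA -IH enorm_sqr.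
Qed.

Lemma st_theta_at t : st_theta (st t) = - \sum_(1 <= k < t.+1) l k.
Proof.
elim: t => [|t IH]; first by rewrite big_geq// oppr0.
by rewrite big_nat_recr//= opprD -IH.
Qed.

Lemma st_S2_ge4 t : 4 <= st_S2 (st t).
Proof. by rewrite st_S2_at lerDl; apply: sumr_ge0 => k _; exact: dotpp_ge0. Qed.

Let S2_gt0 t : 0 < st_S2 (st t).
Proof. exact: lt_le_trans (st_S2_ge4 t). Qed.

(** Each increment of Q is 1 - S_t^2 / S_{t+1}^2 <= ln S_{t+1}^2 - ln S_t^2, and the sum telescopes
    from 0 <= ln 4. *)
Lemma st_Q_le_ln t : st_Q (st t) <= ln (st_S2 (st t)).
Proof.
elim: t => [|t IH]; first by rewrite ln_ge0//= ler1n.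
apply: le_trans (lerD IH (lexx _)) _.
have s0 := S2_gt0 t; have s1 := S2_gt0 t.+1.
rewrite -lerBrDl -lerN2 opprB -[leLHS]/(ln (st_S2 (st t)) - ln (st_S2 (st t.+1))).
rewrite -ln_div ?posrE//.
have -> : st_S2 (st t) / st_S2 (st t.+1) =
    1 + - (enorm (l t.+1) ^+ 2 / st_S2 (st t.+1)).
  rewrite -[X in X + _](mulfV (lt0r_neq0 s1)) -mulNr -mulrDl /= addrK; congr (_ / _).
apply: le_ln1Dx.
rewrite ltrN2 ltr_pdivrMr// mul1r /=; rewrite /l in s1 *; lra.
Qed.

Lemma alg_xE t : alg_x x0 eta g t.+1 - x0 =
  pot t *: dual_arg (st_theta (st t)) (st_S2 (st t)).
Proof. by rewrite /alg_x alg_outputE ?S2_gt0//= addrC addKr. Qed.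

Lemma pot_step t : enorm (l t.+1) <= 1 ->
  pot t.+1 <= pot t - dotp (l t.+1) (alg_x x0 eta g t.+1 - x0).
Proof.
move=> l1; rewrite alg_xE dotpZr -[X in X - _]mulr1 -mulrBr.
rewrite /pot /= -/(st t) -/(l t.+1) enorm_sqr.
exact: dual_potential_step.
Qed.

Lemma pot0 : pot 0 = 1.
Proof.
rewrite /pot /= subr0 /dual_val dotp0l sub0r /dual_arg.
by case: ifP; rewrite scaler0 dotp0l mulr0 oppr0 expR0.
Qed.

Lemma pot_ge0 t : 0 <= pot t.
Proof. exact: expR_ge0. Qed.

(** Each round multiplies the potential by at most 1 + |l| |b| <= 3/2. This crude bound keeps the
    iterates bounded at each fixed time, which makes their products with the gradients
    integrable. *)
Lemma pot_bound t : (forall k, (1 <= k <= t)%N -> enorm (l k) <= 1) ->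
  pot t <= (3 / 2) ^+ t.
Proof.
elim: t => [|t IH] l1; first by rewrite pot0.
have {}IH : pot t <= (3 / 2) ^+ t.
  by apply: IH => k /andP[k1 kt]; rewrite l1// k1 ltnW.
have lt1 : enorm (l t.+1) <= 1 by rewrite l1//=.
apply: le_trans (pot_step _ lt1) _; rewrite alg_xE dotpZr.
set b := dual_arg _ _.
have : - dotp (l t.+1) b <= 1 / 2.
  have b4 : enorm b ^+ 2 <= 1 / 4 by rewrite enorm_sqr dual_arg_sqr_le.
  have := CauchySchwarz_dotp (l t.+1) b; rewrite ler_norml => /andP[+ _].
  have := enorm_ge0 b; have := enorm_ge0 (l t.+1); nra.
have := pot_ge0 t.
rewrite exprS; nra.
Qed.

Lemma alg_x_bound t i : (forall k, (1 <= k <= t)%N -> enorm (l k) <= 1) ->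
  `|alg_x x0 eta g t.+1 ord0 i - x0 ord0 i| <= (3 / 2) ^+ t.
Proof.
move=> l1.
have -> : alg_x x0 eta g t.+1 ord0 i - x0 ord0 i = (alg_x x0 eta g t.+1 - x0) ord0 i.
  by rewrite !mxE.
apply: le_trans (normr_coord_le_enorm _ i) _; rewrite alg_xE enormZ ger0_norm ?pot_ge0//.
apply: le_trans _ (pot_bound _ l1); rewrite ler_piMr ?pot_ge0//.
rewrite -(@expr_le1 _ 2) ?enorm_ge0// enorm_sqr.
by apply: le_trans (dual_arg_sqr_le _ _ (S2_gt0 t)) _; lra.
Qed.

(** [pot_step] telescopes from [pot 0 = 1]. *)
Lemma regret_origin T : (forall k, (1 <= k <= T)%N -> enorm (l k) <= 1) ->
  \sum_(1 <= t < T.+1) dotp (l t) (alg_x x0 eta g t - x0) <= 1 - pot T.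
Proof.
elim: T => [|T IH] l1; first by rewrite big_geq// pot0 subrr.
rewrite big_nat_recr//=.
have {}IH : \sum_(1 <= t < T.+1) dotp (l t) (alg_x x0 eta g t - x0) <= 1 - pot T.
  by apply: IH => k /andP[k1 kT]; rewrite l1// k1 ltnW.
have lT : enorm (l T.+1) <= 1 by rewrite l1//=.
by have := pot_step _ lT; lra.
Qed.

(** Moving the comparator from x0 to u adds - <sum l_t, u - x0>, and theta_T is minus that sum. *)
Lemma regret_comparator T (u : 'rV[R]_d) :
  (forall k, (1 <= k <= T)%N -> enorm (l k) <= 1) ->
  \sum_(1 <= t < T.+1) dotp (l t) (alg_x x0 eta g t - u) <=
  1 + (dotp (st_theta (st T)) (u - x0) - pot T).
Proof.
move=> l1; rewrite st_theta_at dotpNl dotp_suml addrCA -lerBlDl opprK.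
apply: le_trans (regret_origin _ l1); rewrite -big_split/=.
by apply: ler_sum => t _; rewrite -dotpDr addrA subrK.
Qed.

(** Here [s] stands for S_T^2, [M] for an upper bound on S_T and [v] for u - x0. The condition
    [2 <= M] places a test vector of norm 1/M inside the ball of radius 1/2. *)
Lemma dual_conj_bound (s Q M : R) (th v : 'rV[R]_d) :
  0 < s -> 2 <= M -> s <= M ^+ 2 -> Q <= ln s ->
  dotp th v - expR (dual_val th s - Q) <=
  M * enorm v * (2 * ln (1 + 2 * enorm v) + 9 * M).
Proof.
move=> s0 M2 sM Qs; have [v0|v0] := eqVneq (enorm v) 0.
  by rewrite v0 (enorm_eq0 _ v0) dotpC dotp0l mulr0 mul0r sub0r oppr_le0 expR_ge0.
have D0 : 0 < enorm v by rewrite lt_def v0 enorm_ge0.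
have M0 : 0 < M by lra.
set D := enorm v in v0 D0 *; pose c := D * M.
have c0 : 0 < c by rewrite mulr_gt0.
(* compare dual_val with its value at the vector of norm 1/M in the direction of v *)
have := dual_val_ge th s (c^-1 *: v) s0.
rewrite !dotpE -enorm_sqr -/D.
have -> : c^-1 * (c^-1 * D ^+ 2) = (M ^+ 2)^-1 by rewrite /c; field; lra.
have MV4 : (M ^+ 2)^-1 <= 1 / 4.
  by rewrite -[1 / 4]invrK lef_pV2 ?posrE; nra.
move=> /(_ MV4); set V := dual_val th s => hV.
have sM1 : s * (M ^+ 2)^-1 <= 1 by rewrite ler_pdivrMr ?exprn_gt0// mul1r.
have lnc : ln c = ln D + ln M by rewrite lnM ?posrE.
(* The tangent of exp at ln c. Subtracted from c (V + 1), it leaves c (Q + ln c), where Q + ln c <=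
   ln D + 3 ln M. *)
have : c * (1 + (V - Q - ln c)) <= expR (V - Q).
  have -> : expR (V - Q) = c * expR (V - Q - ln c).
    by rewrite [in RHS]expRD expRN lnK ?posrE// mulrCA divff ?mulr1// lt0r_neq0.
  by rewrite ler_pM2l// expR_ge1Dx.
have lnD : ln D <= ln (1 + 2 * D) by rewrite ler_ln ?posrE; lra.
have lnD0 : 0 <= ln (1 + 2 * D) by rewrite ln_ge0; lra.
have lnM : ln M <= M by rewrite ltW// ln_sublinear.
have lns : ln s <= 2 * ln M.
  by rewrite mulr_natl -lnXn// ler_ln ?posrE ?exprn_gt0.
have cth : dotp th v <= c * (V + 1).
  by rewrite mulrC -ler_pdivrMr//; lra.
have : c * (Q + ln c) <= c * (2 * ln (1 + 2 * D) + 9 * M) by rewrite ler_pM2l; lra.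
rewrite (mulrC M) -/c; lra.
Qed.

End Regret.

(** * Sums of negative powers *)

Section PowerSum.
Context {R : realType}.

(** This follows from exp x >= 1 + x at x = q (ln (n + 1) - ln n), together with ln (n + 1) - ln n
    >= 1 / (n + 1). *)
Lemma powR_telescope_le (q : R) (n : nat) : 0 < q -> (0 < n)%N ->
  q * (n.+1%:R `^ (- q) / n.+1%:R) <= n%:R `^ (- q) - n.+1%:R `^ (- q).
Proof.
move=> q0 n0; have N0 : 0 < n%:R :> R by rewrite ltr0n.
have N1 : 0 < n.+1%:R :> R by rewrite ltr0n.
have -> : n%:R `^ (- q) = n.+1%:R `^ (- q) * expR (q * (ln n.+1%:R - ln n%:R)).
  by rewrite /powR !gt_eqF// -expRD; congr expR; ring.
have lnle : n.+1%:R^-1 <= ln n.+1%:R - ln n%:R :> R.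
  rewrite -lerN2 opprB -ln_div ?posrE//.
  have -> : n%:R / n.+1%:R = 1 + - n.+1%:R^-1 :> R.
    by rewrite -natr1; field; rewrite natr1 gt_eqF.
  by apply: le_ln1Dx; rewrite ltrN2 invf_lt1// ltr1n.
have : 1 + q * n.+1%:R^-1 <= expR (q * (ln n.+1%:R - ln n%:R)).
  by apply: le_trans (expR_ge1Dx _); rewrite lerD2l ler_pM2l.
have := powR_gt0 (- q) N1; set p := _ `^ _; set e := expR _; set v := _^-1.
nra.
Qed.

Lemma powR_sum_le (alpha : R) (T : nat) : 1 / 2 < alpha ->
  \sum_(1 <= t < T.+1) (t%:R `^ alpha) ^- 2 <= 1 + (2 * alpha - 1)^-1.
Proof.
move=> a2; have q0 : 0 < 2 * alpha - 1 by lra.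
set q := 2 * alpha - 1 in q0 *.
have qV : 0 < q^-1 by rewrite invr_gt0.
case: T => [|T]; first by rewrite big_geq// addr_ge0// ltW.
(* The induction carries the telescoped remainder; with q = 2 alpha - 1 each term is t^(-q) / t. *)
suff h : \sum_(1 <= t < T.+2) (t%:R `^ alpha) ^- 2 <= 1 + q^-1 * (1 - T.+1%:R `^ (- q)).
  apply: le_trans h _; have := powR_ge0 T.+1%:R (- q); nra.
elim: T => [|T IH].
  by rewrite big_nat1 powR1 expr1n invr1 subrr mulr0 addr0.
rewrite big_nat_recr//=; apply: le_trans (lerD IH (lexx _)) _.
rewrite -addrA lerD2l -lerBrDl -mulrBr.
have -> : (T.+2%:R `^ alpha) ^- 2 = T.+2%:R `^ (- q) / T.+2%:R :> R.
  rewrite -powR_mulrn ?powR_ge0// -powRrM -powRN.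
  rewrite -[X in _ = _ / X]powRr1// -powRB ?pnatr_eq0 ?implybT//.
  by congr (_ `^ _); rewrite /q; ring.
rewrite -(ler_pM2l q0) [leRHS]mulVKf ?gt_eqF//.
apply: le_trans (powR_telescope_le _ _ q0 (ltn0Sn T)) _.
by rewrite le_eqVlt; apply/orP; left; apply/eqP; ring.
Qed.

End PowerSum.

(** * Gradient inequality and Jensen for convex differentiable functions *)

Section Convexity.
Context {R : realType} {d : nat} (F : 'rV[R]_d -> R).
Hypotheses (Fcvx : convex_fun F) (Fdiff : forall x, differentiable F x).

(** Differentiability makes the directional derivative linear in [v], so the partial derivatives
    determine it. *)
Lemma dotp_gradE x v : dotp (grad F x) v = 'D_v F x.
Proof.
rewrite deriveE//; rewrite {2}[v]row_sum_delta linear_sum.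
by apply: eq_bigr => i _; rewrite mxE linearZ/= deriveE// mulrC.
Qed.

(** Convexity bounds the difference quotients with 0 < h <= 1 by F y - F x; then h decreases to
    0. *)
Lemma convex_grad_le x y : F x + dotp (grad F x) (y - x) <= F y.
Proof.
rewrite dotp_gradE -lerBrDl.
have dF : derivable F x (y - x) by exact: diff_derivable.
have := cvg_dnbhs_at_right dF.
move=> /cvgr_to_le; apply.
near=> h.
have h0 : 0 < h by near: h; exact: nbhs_right_gt.
have h1 : h <= 1 by near: h; apply: nbhs_right_le.
rewrite /= ler_pdivrMl// lerBlDr.
have -> : h *: (y - x) + x = (1 - h) *: x + h *: y.
  by rewrite scalerBr scalerBl scale1r; rewrite addrAC -addrA addrC.
apply: le_trans (Fcvx _ _ _ _) _; first by rewrite ltW.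
lra.
Unshelve. all: by end_near. Qed.

(** Jensen from the gradient inequality at the average, where the linear terms sum to zero. *)
Lemma convex_average_le (f : nat -> 'rV[R]_d) (T : nat) : (0 < T)%N ->
  F (T%:R^-1 *: \sum_(1 <= t < T.+1) f t) <= T%:R^-1 * \sum_(1 <= t < T.+1) F (f t).
Proof.
move=> T0; have T1 : 0 < T%:R :> R by rewrite ltr0n.
set xb := _ *: _.
have /(ler_sum (index_iota 1 T.+1)) := fun t (_ : xpredT t) => convex_grad_le xb (f t).
have E : \sum_(1 <= t < T.+1) dotp (grad F xb) (f t - xb) = 0.
  under eq_bigr do rewrite dotpC.
  rewrite -dotp_suml sumrB big_const_nat subn1 iter_addr_0 /=.
  by rewrite -scaler_nat /xb scalerA mulfV ?gt_eqF// scale1r subrr dotp0l.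
rewrite big_split/= E addr0 big_const_nat subn1 iter_addr_0/=.
by rewrite ler_pdivlMl // mulr_natl.
Qed.

End Convexity.

(** * Integrals of products with a bounded random variable *)

Lemma floor_count_approx {R : realType} (N : nat) (y : R) : 0 <= y <= N%:R ->
  y - 1 <= \sum_(k < N) (k.+1%:R <= y)%R%:R <= y.
Proof.
move=> /andP[y0 yN].
(* The sum counts the integers 1, ..., N not exceeding [y]. Induction on [N] must also cover
   [N < y], where every term is 1. *)
suff [h1 h2] : \sum_(k < N) (k.+1%:R <= y)%R%:R <= y /\
    (if y <= N%:R then y - 1 <= \sum_(k < N) (k.+1%:R <= y)%R%:R
     else \sum_(k < N) (k.+1%:R <= y)%R%:R == N%:R :> R).
  by rewrite yN in h2; rewrite h1 h2.
elim: N {yN} => [|N [IH1 IH2]].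
  rewrite !big_ord0; split => //; case: ifPn; last by [].
  by move=> y1; lra.
rewrite !big_ord_recr/=.
have [yN|yN] := leP N.+1%:R y.
  have nyN : (y <= N%:R) = false.
    by apply/negbTE; rewrite -ltNge; apply: lt_le_trans yN; rewrite ltr_nat.
  rewrite nyN in IH2; rewrite (eqP IH2) natr1; split => //.
  by case: ifPn => // yN'; lra.
rewrite addr0; split => //; rewrite ltW//.
move: IH2; case: ifPn => // _ /eqP ->.
by rewrite lerBlDr natr1 ltW.
Qed.

Section Integration.
Local Open Scope ereal_scope.
Context {dO : measure_display} {T : measurableType dO} {R : realType}.

(* No measurability is needed, the integral being a difference of suprema of
   integrals of simple functions; this is why F o xbar is never shown measurable. *)
Lemma integral_mono (mu : {measure set T -> \bar R}) (f h : T -> \bar R) :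
  (forall w, f w <= h w) -> \int[mu]_w f w <= \int[mu]_w h w.
Proof.
move=> fh; rewrite /integral; apply: leeB; apply: le_ereal_sup => _ [k kf <-];
  exists k => //= w; apply: le_trans (kf w) _; rewrite !patch_setT.
- by apply: funepos_le => //; rewrite inE.
- by apply: funeneg_le => //; rewrite inE.
Qed.

Lemma integrable_mul_ae_bounded (mu : {measure set T -> \bar R}) (W Z : T -> R) (M : R) :
  mu.-integrable setT (EFin \o W) -> measurable_fun setT Z ->
  {ae mu, forall w, (`|Z w| <= M)%R} ->
  mu.-integrable setT (EFin \o (W \* Z)%R).
Proof.
move=> iW mZ ZM; have /integrableP[mW Wfin] := iW.
have mW' : measurable_fun setT W by exact/measurable_EFinP.
apply/integrableP; split; first by apply/measurable_EFinP; exact: measurable_funM.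
apply: (@le_lt_trans _ _ (\int[mu]_w (`|M|%:E * `|(W w)%:E|))).
  apply: ae_ge0_le_integral => //.
  - by apply: measurableT_comp => //; apply/measurable_EFinP; exact: measurable_funM.
  - by apply: emeasurable_funM => //; exact: measurableT_comp.
  - apply: filterS ZM => w ZM _ /=; rewrite -EFinM lee_fin normrM mulrC ler_wpM2r//.
    by apply: le_trans ZM _; exact: ler_norm.
rewrite ge0_integralZl//; first exact: lte_mul_pinfty.
exact: measurableT_comp.
Qed.

Local Open Scope ring_scope.

Lemma integrable_sumR (mu : {measure set T -> \bar R}) (I : Type) (s : seq I) (f : I -> T -> R) :
  (forall i, mu.-integrable setT (EFin \o f i)) ->
  mu.-integrable setT (EFin \o (fun w => \sum_(i <- s) f i w)).
Proof.
move=> fi; rewrite (_ : EFin \o _ = fun w => (\sum_(i <- s) (f i w)%:E)%E).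
  by apply: integrable_sum => // i _; exact: fi.
by apply/funext => w /=; rewrite sumEFin.
Qed.

Lemma Rintegral_sum (mu : {measure set T -> \bar R}) (I : Type) (s : seq I) (f : I -> T -> R) :
  (forall i, mu.-integrable setT (EFin \o f i)) ->
  \int[mu]_w (\sum_(i <- s) f i w) = \sum_(i <- s) \int[mu]_w f i w.
Proof.
move=> fi; elim: s => [|i s IH].
  under eq_Rintegral do rewrite big_nil.
  by rewrite big_nil /Rintegral integral0.
under eq_Rintegral do rewrite big_cons.
by rewrite RintegralD// ?IH ?big_cons//; exact: integrable_sumR.
Qed.

(* The staircase sum_(k < N) 1_{k + 1 <= N Z} / N is within 1/N of Z, and W has
   zero integral on each of its steps. *)
Lemma Rintegral_mul_level_sets0 (P : probability T R) (W Z : T -> R) :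
  P.-integrable setT (EFin \o W) -> measurable_fun setT Z ->
  (forall w, 0 <= Z w <= 1) ->
  (forall a, \int[P]_(w in [set w | a <= Z w]) W w = 0) ->
  \int[P]_w (W w * Z w) = 0.
Proof.
move=> iW mZ Z01 W0.
have mle a : measurable [set w | a <= Z w].
  by rewrite -[X in measurable X]setTI; exact: measurable_fun_ler.
have iM (V : T -> R) : measurable_fun setT V -> (forall w, `|V w| <= 1) ->
    P.-integrable setT (EFin \o (W \* V)).
  by move=> mV V1; apply: (integrable_mul_ae_bounded _ _ _ 1) => //; exact: nearW.
have mI a : measurable_fun setT (fun w => (a <= Z w)%R%:R : R).
  by rewrite (_ : (fun _ => _) = \1_[set w | a <= Z w]);
    [exact: measurable_indic | apply/funext => w; rewrite indicE mem_setE].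
have iI a : P.-integrable setT (EFin \o (fun w => W w * (a <= Z w)%R%:R)).
  by apply: iM => // w; case: (a <= Z w); rewrite ?normr1 ?normr0.
have intI a : \int[P]_w (W w * (a <= Z w)%R%:R) = 0.
  rewrite -(W0 a) [RHS]Rintegral_mkcond; apply: eq_Rintegral => w _.
  rewrite patchE (_ : (w \in _) = (a <= Z w)); last by apply/idP/idP; rewrite inE.
  by case: (a <= Z w); rewrite ?mulr1 ?mulr0.
have iWZ : P.-integrable setT (EFin \o (W \* Z)).
  by apply: iM => // w; rewrite ger0_norm; case/andP: (Z01 w).
(* [V N] is [W] times the number of levels (k + 1) / (N + 1) not exceeding [Z]. *)
pose V N w : R := \sum_(k < N.+1) W w * (k.+1%:R / N.+1%:R <= Z w)%R%:R.
have iV N : P.-integrable setT (EFin \o V N) by exact: integrable_sumR.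
have intV N : \int[P]_w V N w = 0.
  by rewrite Rintegral_sum// big1.
have iZV N : P.-integrable setT (EFin \o (fun w => N.+1%:R * (W w * Z w) - V N w)).
  have := integrableB measurableT (integrableZl measurableT N.+1%:R iWZ) (iV N).
  exact.
have iaW : P.-integrable setT (EFin \o (fun w => `|W w|)) by exact: integrable_norm.
(* Subtracting [V N], of integral zero, leaves an integrand bounded by |W|, since the count is
   within 1 of (N + 1) Z. Letting N grow forces the integral to vanish. *)
have le1 N : N.+1%:R * `|\int[P]_w (W w * Z w)| <= \int[P]_w `|W w|.
  rewrite -[X in X * _]ger0_norm// -normrM -RintegralZl//.
  rewrite -[X in `|X|]subr0 -(intV N) -RintegralB//; last first.
    exact: (integrableZl measurableT N.+1%:R iWZ).
  apply: le_trans (le_normr_Rintegral _ (iZV N)) _ => //.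
  apply: le_Rintegral => //; first exact: (integrable_norm (iZV N)).
  move=> w _; rewrite /V -mulr_sumr mulrCA -mulrBr normrM ler_piMr//.
  have /floor_count_approx : 0 <= N.+1%:R * Z w <= N.+1%:R.
    by have /andP[z0 z1] := Z01 w; rewrite mulr_ge0//= ler_piMr.
  under eq_bigr do rewrite -ler_pdivrMl// mulrC.
  by rewrite ler_norml => /andP[]; lra.
apply/eqP; rewrite -normr_le0 leNgt; apply/negP => c0.
set c := `|_| in c0 le1; set J := (\int[P]_w `|W w|)%R in le1.
have := le1 (Num.truncn (J / c)); apply/negP; rewrite -ltNge.
by rewrite -ltr_pdivrMr//; exact: truncnS_gt.
Qed.

(** An affine change of variable brings [Z] into [0, 1], where [Rintegral_mul_level_sets0] applies
    to X - Y: its level sets are preimages under [Z]. *)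
Lemma Rintegral_mul_comp_eq (P : probability T R) (X Y Z : T -> R) (M : R) :
  P.-integrable setT (EFin \o X) -> P.-integrable setT (EFin \o Y) ->
  measurable_fun setT Z -> {ae P, forall w, `|Z w| <= M} ->
  (forall B : set R, measurable B ->
     \int[P]_(w in Z @^-1` B) X w = \int[P]_(w in Z @^-1` B) Y w) ->
  \int[P]_w (X w * Z w) = \int[P]_w (Y w * Z w).
Proof.
move=> iX iY mZ ZM XY.
(* [Z] is bounded only almost everywhere, so clipping enforces the range [0, 1] at every point. The
   added 1 makes [K] positive. *)
pose K := `|M| + 1; have K0 : 0 < K by rewrite ltr_wpDl.
pose clip z : R := Num.max 0 (Num.min 1 ((z + K) / (2 * K))).
have mclip : measurable_fun setT clip.
  apply: measurable_maxr => //; apply: measurable_minr => //.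
  by apply: measurable_funM => //; exact: measurable_funD.
have mB a : measurable [set z | a <= clip z].
  by rewrite -[X in measurable X]setTI; exact: measurable_fun_ler.
have clip01 z : 0 <= clip z <= 1.
  by rewrite /clip le_max lexx/= ge_max ler01 ge_min lexx.
have mclipZ : measurable_fun setT (clip \o Z) by exact: measurableT_comp.
pose W := X \- Y.
have iW : P.-integrable setT (EFin \o W) := integrableB measurableT iX iY.
have WB B : measurable B -> \int[P]_(w in Z @^-1` B) W w = 0.
  move=> /[dup] mB' /XY XYB.
  have mZB : measurable (Z @^-1` B) by rewrite -[X in measurable X]setTI; exact: mZ.
  by rewrite RintegralB// ?XYB ?subrr//; exact: (integrableS measurableT).
have iWc : P.-integrable setT (EFin \o (W \* (clip \o Z))).
  apply: (integrable_mul_ae_bounded _ _ _ 1) => //.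
  by apply: nearW => w; rewrite ger0_norm; case/andP: (clip01 (Z w)).
have Wc0 : \int[P]_w (W w * clip (Z w)) = 0.
  by apply: Rintegral_mul_level_sets0 => // a; exact: (WB [set z | a <= clip z]).
have W0 : \int[P]_w W w = 0 by rewrite -(WB setT)// preimage_setT.
have iXZ := integrable_mul_ae_bounded _ _ _ _ iX mZ ZM.
have iYZ := integrable_mul_ae_bounded _ _ _ _ iY mZ ZM.
apply/eqP; rewrite -subr_eq0 -RintegralB//; apply/eqP.
(* Almost everywhere the clipping is inactive and Z = 2 K clip (Z) - K; the constant part
   contributes nothing because [W] has integral zero. *)
transitivity (\int[P]_w (2 * K * (W w * clip (Z w)) - K * W w)); last first.
  rewrite RintegralB//; first by rewrite !RintegralZl// Wc0 W0 !mulr0 subrr.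
  - exact: (integrableZl measurableT _ iWc).
  - exact: (integrableZl measurableT _ iW).
congr fine; apply: ae_eq_integral => //.
- exact: measurable_int (integrableB measurableT iXZ iYZ).
- exact: measurable_int (integrableB measurableT
    (integrableZl measurableT (2 * K) iWc) (integrableZl measurableT K iW)).
apply: filterS ZM => w ZM _ /=; congr EFin.
have : `|M| >= M by exact: ler_norm.
move: ZM; rewrite ler_norml => /andP[Z1 Z2] MM.
have -> : clip (Z w) = (Z w + K) / (2 * K).
  rewrite /clip min_r ?max_r//; first by rewrite divr_ge0 /K; lra.
  by rewrite ler_pdivrMr /K; lra.
by rewrite /W /=; field; lra.
Qed.

End Integration.

(** * Measurability of the iterates *)

Section Measurability.
Context {dO : measure_display} {Omega : measurableType dO} {R : realType} {d : nat}.

(** Stated by coordinates, like the generators of [filt] and the hypothesis on [g]. *)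
Definition measurable_rV (f : Omega -> 'rV[R]_d) : Prop :=
  forall i, measurable_fun setT (fun w => f w ord0 i).

Lemma measurable_dotp (f h : Omega -> 'rV[R]_d) :
  measurable_rV f -> measurable_rV h ->
  measurable_fun setT (fun w => dotp (f w) (h w)).
Proof. by move=> mf mh; apply: measurable_sum => i; exact: measurable_funM. Qed.

Lemma measurable_enorm (f : Omega -> 'rV[R]_d) :
  measurable_rV f -> measurable_fun setT (fun w => enorm (f w)).
Proof.
move=> mf; rewrite (_ : (fun _ => _) = fun w => dotp (f w) (f w) `^ 2^-1).
  by apply: (measurableT_comp (measurable_powR _)); exact: measurable_dotp.
by apply/funext => w; rewrite powR12_sqrt ?dotpp_ge0// -enorm_sqr sqrtr_sqr ger0_norm ?enorm_ge0.
Qed.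

(** On nonnegative reals inversion is the power -1, also at 0, where both give 0 by convention. *)
Lemma measurable_inv_ge0 (f : Omega -> R) : (forall w, 0 <= f w) ->
  measurable_fun setT f -> measurable_fun setT (fun w => (f w)^-1).
Proof.
move=> f0 mf; rewrite (_ : (fun _ => _) = fun w => f w `^ (-1)).
  exact: (measurableT_comp (measurable_powR _)).
by apply/funext => w; rewrite powR_inv1.
Qed.

Variables (eta : nat -> R) (g : nat -> Omega -> 'rV[R]_d).
Hypothesis mg : forall t, measurable_rV (g t).
Let st t w := alg_state_at eta (g^~ w) t.

Lemma measurable_alg_state t :
  [/\ measurable_fun setT (fun w => st_S2 (st t w)),
      measurable_fun setT (fun w => st_Q (st t w)) &
      measurable_rV (fun w => st_theta (st t w))].
Proof.
elim: t => [|t [mS mQ mth]]; first by split => // i; rewrite /st/=.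
have ml : measurable_rV (fun w => eta t.+1 *: g t.+1 w).
  move=> i; under [X in measurable_fun _ X]eq_fun do rewrite mxE.
  by apply: measurable_funM => //; exact: mg.
have mn : measurable_fun setT (fun w => enorm (eta t.+1 *: g t.+1 w) ^+ 2).
  by apply: measurable_funX; exact: measurable_enorm.
have mS' : measurable_fun setT (fun w => st_S2 (st t.+1 w)).
  exact: measurable_funD.
split => //.
- apply: measurable_funD => //; apply: measurable_funM => //.
  apply: measurable_inv_ge0 => // w.
  by apply: le_trans (st_S2_ge4 eta (g^~ w) t.+1).
- move=> i; under [X in measurable_fun _ X]eq_fun do rewrite 2!mxE.
  by apply: measurable_funB; [exact: mth|exact: ml].
Qed.

Lemma measurable_alg_x x0 t : measurable_rV (fun w => alg_x x0 eta (g^~ w) t).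
Proof.
have [mS mQ mth] := measurable_alg_state t.-1.
have mn := measurable_enorm _ mth.
have S0 w : 0 <= st_S2 (st t.-1 w).
  by apply: le_trans (st_S2_ge4 eta (g^~ w) t.-1).
move=> i; rewrite /alg_x /alg_output.
rewrite (_ : (fun _ => _) = fun w =>
  if enorm (st_theta (st t.-1 w)) <= st_S2 (st t.-1 w) then
    x0 ord0 i + expR (enorm (st_theta (st t.-1 w)) ^+ 2 / (4 * st_S2 (st t.-1 w))
      - st_Q (st t.-1 w)) / (2 * st_S2 (st t.-1 w)) * st_theta (st t.-1 w) ord0 i
  else
    x0 ord0 i + expR (enorm (st_theta (st t.-1 w)) / 2 - st_S2 (st t.-1 w) / 4
      - st_Q (st t.-1 w)) / (2 * enorm (st_theta (st t.-1 w)))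
      * st_theta (st t.-1 w) ord0 i); last first.
  by apply/funext => w; rewrite -/(st t.-1 w); case: ifP => _; rewrite !mxE.
have mS4 : measurable_fun setT (fun w => (4 * st_S2 (st t.-1 w))^-1).
  by apply: measurable_inv_ge0 => [w|]; [rewrite mulr_ge0|exact: measurable_funM].
have mS2 : measurable_fun setT (fun w => (2 * st_S2 (st t.-1 w))^-1).
  by apply: measurable_inv_ge0 => [w|]; [rewrite mulr_ge0|exact: measurable_funM].
have mn2 : measurable_fun setT (fun w => (2 * enorm (st_theta (st t.-1 w)))^-1).
  by apply: measurable_inv_ge0 => [w|]; [rewrite mulr_ge0 ?enorm_ge0|exact: measurable_funM].
apply: measurable_fun_ifT; first exact: measurable_fun_ler.
- apply: measurable_funD => //; apply: measurable_funM; last exact: mth.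
  apply: measurable_funM ; last exact: mS2.
  apply: (measurableT_comp (@measurable_expR R)).
  apply: measurable_funB => //; apply: measurable_funM; last exact: mS4.
  exact: measurable_funX.
- apply: measurable_funD => //; apply: measurable_funM; last exact: mth.
  apply: measurable_funM ; last exact: mn2.
  apply: (measurableT_comp (@measurable_expR R)).
  by apply: measurable_funB => //; apply: measurable_funB; exact: measurable_funM.
Qed.

End Measurability.

(** * Regret and suboptimality for the rates 1 / (G t^alpha) *)

Section ExpectedRegret.
Context {R : realType} {d : nat} (alpha G : R).
Hypotheses (alpha12 : 1 / 2 < alpha) (G0 : 0 < G).

Let eta (t : nat) : R := (G * (t%:R `^ alpha))^-1.

Let powR_ge1 t : (1 <= t)%N -> 1 <= t%:R `^ alpha.
Proof.
move=> t1; rewrite -{1}(powRr0 t%:R); apply: ler_powR; first by rewrite ler1n.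
by move: alpha12; lra.
Qed.

Lemma rate_gt0 t : (1 <= t)%N -> 0 < eta t.
Proof.
by move=> /powR_ge1 t1; rewrite invr_gt0 mulr_gt0//; exact: lt_le_trans t1.
Qed.

Lemma rate_nincr s t : (1 <= s <= t)%N -> eta t <= eta s.
Proof.
move=> /andP[s1 st]; have t1 := leq_trans s1 st.
rewrite lef_pV2 ?posrE; try by rewrite -invr_gt0; exact: rate_gt0.
rewrite ler_pM2l//; apply: ge0_ler_powR; rewrite ?nnegrE ?ler_nat//.
by move: alpha12; lra.
Qed.

Lemma enorm_rate_le t (v : 'rV[R]_d) : (1 <= t)%N -> enorm v <= G ->
  enorm (eta t *: v) <= (t%:R `^ alpha)^-1.
Proof.
move=> t1 vG; rewrite enormZ ger0_norm; last by rewrite ltW// rate_gt0.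
have p0 := lt_le_trans ltr01 (powR_ge1 _ t1).
apply: le_trans (ler_wpM2l _ vG) _; first by rewrite ltW// rate_gt0.
by rewrite /eta le_eqVlt; apply/orP; left; apply/eqP; field; rewrite !gt_eqF.
Qed.

Lemma enorm_rate_le1 t (v : 'rV[R]_d) : (1 <= t)%N -> enorm v <= G ->
  enorm (eta t *: v) <= 1.
Proof.
move=> t1 vG; apply: le_trans (enorm_rate_le _ _ t1 vG) _.
by rewrite invf_le1 ?powR_ge1//; exact: lt_le_trans (powR_ge1 _ t1).
Qed.

Let M := Num.sqrt (5 + (2 * alpha - 1)^-1).

Lemma regret_bound (x0 u : 'rV[R]_d) (g : nat -> 'rV[R]_d) (T : nat) :
  (forall t, (1 <= t <= T)%N -> enorm (g t) <= G) ->
  \sum_(1 <= t < T.+1) eta t * dotp (g t) (alg_x x0 eta g t - u) <=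
  1 + M * enorm (u - x0) * (2 * ln (1 + 2 * enorm (u - x0)) + 9 * M).
Proof.
move=> gG.
have l1 t : (1 <= t <= T)%N -> enorm (eta t *: g t) <= 1.
  by move=> tT; apply: enorm_rate_le1; [case/andP: tT | exact: gG].
under eq_bigr do rewrite -dotpZl.
apply: le_trans (regret_comparator x0 eta g T u l1) _; rewrite lerD2l.
have q0 : 0 < (2 * alpha - 1)^-1 by rewrite invr_gt0; move: alpha12; lra.
have MM : M ^+ 2 = 5 + (2 * alpha - 1)^-1 by rewrite sqr_sqrtr; lra.
apply: dual_conj_bound.
- by apply: lt_le_trans (st_S2_ge4 eta g T).
- rewrite -(@ler_pXn2r _ 2)// ?nnegrE ?sqrtr_ge0// MM; lra.
- rewrite st_S2_at MM.
  (* The 4 is the initial S_0^2; the rest bounds the sum of t^(-2 alpha), since |l_t| <=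
     t^(-alpha). *)
  have -> : 5 + (2 * alpha - 1)^-1 = 4 + (1 + (2 * alpha - 1)^-1) by ring.
  rewrite lerD2l; apply: le_trans (powR_sum_le _ T alpha12).
  rewrite big_nat [leRHS]big_nat; apply: ler_sum => t /andP[t1 tT].
  rewrite -enorm_sqr -exprVn.
  apply: lerXn2r; rewrite ?nnegrE ?enorm_ge0 ?invr_ge0 ?powR_ge0//.
  by apply: enorm_rate_le => //; apply: gG; rewrite t1.
- exact: st_Q_le_ln.
Qed.

Lemma average_suboptimality_le (F : 'rV[R]_d -> R) (xstar : 'rV[R]_d)
  (x : nat -> 'rV[R]_d) (T : nat) : (1 <= T)%N ->
  convex_fun F -> (forall y, differentiable F y) -> (forall y, F xstar <= F y) ->
  F (T%:R^-1 *: \sum_(1 <= t < T.+1) x t) <=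
  F xstar + (T%:R * eta T)^-1 *
    \sum_(1 <= t < T.+1) eta t * dotp (grad F (x t)) (x t - xstar).
Proof.
move=> T1 Fcvx Fdiff Fmin; have T0 : 0 < T%:R :> R by rewrite ltr0n.
have eT := rate_gt0 T T1.
apply: le_trans (convex_average_le F Fcvx Fdiff x T T1) _.
have -> : F xstar = T%:R^-1 * \sum_(1 <= t < T.+1) F xstar.
  by rewrite big_const_nat subn1 iter_addr_0/= -[X in _ = _ * X]mulr_natl mulKf ?gt_eqF.
rewrite invfM -mulrA -mulrDr ler_pM2l ?invr_gt0// -lerBlDl -sumrB mulr_sumr.
rewrite big_nat [leRHS]big_nat; apply: ler_sum => t tT.
have t1 : (1 <= t <= T)%N by [].
rewrite ler_pdivlMl//.
(* Minimality makes the gap nonnegative, so the weight [eta T] may be raised to [eta t]. *)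
apply: (@le_trans _ _ (eta t * (F (x t) - F xstar))).
  by rewrite ler_wpM2r ?subr_ge0// rate_nincr.
rewrite ler_pM2l ?rate_gt0//; last by case/andP: t1.
have := convex_grad_le F Fcvx Fdiff (x t) xstar.
by rewrite -(opprB xstar) dotpNr; lra.
Qed.

End ExpectedRegret.

(** * From pathwise bounds to expectations *)

Lemma integral_le_ae_cst {dO : measure_display} {Omega : measurableType dO} {R : realType}
  (P : probability Omega R) (V : Omega -> R) (B : R) :
  measurable_fun setT V -> {ae P, forall w, V w <= B} ->
  (\int[P]_w (V w)%:E <= B%:E)%E.
Proof.
move=> mV VB.
(* Capping [V] at [B] changes it only on a null set and makes the bound hold everywhere. *)
rewrite (ae_eq_integral (fun w => (Num.min (V w) B)%:E))//.
- apply: (@le_trans _ _ (\int[P]_w (cst B%:E) w)%E).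
    by apply: integral_mono => w; rewrite lee_fin ge_min lexx orbT.
  by rewrite integral_cst//= probability_setT mule1.
- exact/measurable_EFinP.
- by apply/measurable_EFinP; exact: measurable_minr.
- by apply: filterS VB => w VB _ /=; rewrite min_l.
Qed.

Theorem theorem2 (R : realType) (d : nat)
  (dO : measure_display) (Omega : measurableType dO) (P : probability Omega R)
  (F : 'rV[R]_d -> R) (xstar x0 : 'rV[R]_d) (alpha G : R)
  (g : nat -> Omega -> 'rV[R]_d) :
  convex_fun F ->
  (forall x, differentiable F x) ->
  (forall x, F xstar <= F x) ->
  1 / 2 < alpha < 1 ->
  0 < G ->
  let eta := fun t : nat => (G * (t%:R `^ alpha))^-1 in
  let x := fun (t : nat) (w : Omega) => alg_x x0 eta (fun s => g s w) t in
  (forall (t : nat) (i : 'I_d), measurable_fun setT (fun w => g t w ord0 i)) ->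
  (forall t : nat, (1 <= t)%N ->
     is_cond_exp P (filt x g t) (g t) (fun w => grad F (x t w))) ->
  (forall t : nat, (1 <= t)%N -> {ae P, forall w, enorm (g t w) <= G}) ->
  forall T : nat, (1 <= T)%N ->
    let S := Num.sqrt (5 + (2 * alpha - 1)^-1) in
    let D := enorm (xstar - x0) in
    (\int[P]_w (F (alg_xbar x0 eta (fun s => g s w) T))%:E
      <= (F xstar + G / (T%:R `^ (1 - alpha))
            * (1 + S * D * (2 * ln (1 + 2 * D) + 9 * S)))%:E)%E.
Proof.
move=> Fcvx Fdiff Fmin /andP[a12 _] G0 eta x mg condg gG T T1; lazy zeta.
set S := Num.sqrt _; set D := enorm _.
have mx t := measurable_alg_x eta g mg x0 t.
pose gr t w := grad F (x t w).
(* A single null set serves all times; index 0 is vacuous. *)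
have gGall : {ae P, forall w, forall t, (1 <= t)%N -> enorm (g t w) <= G}.
  apply: ae_foralln => t; case: (ltnP 0 t) => [t1|t0].
    by apply: filterS (gG t t1).
  by apply: aeW => w; move: t0; rewrite leqn0 => /eqP ->.
pose Z t (i : 'I_d) w := x t w ord0 i - xstar ord0 i.
have mZ t i : measurable_fun setT (Z t i).
  by apply: measurable_funB => //; exact: mx.
(* The exponent is [t.-1] because x_t depends on the first t - 1 losses only; the second term passes
   from x0 to xstar. *)
pose M t (i : 'I_d) := (3 / 2) ^+ t.-1 + `|x0 ord0 i - xstar ord0 i|.
have ZM t i : (1 <= t)%N -> {ae P, forall w, `|Z t i w| <= M t i}.
  case: t => // t _; apply: filterS gGall => w gw.
  rewrite /Z -(subrK (x0 ord0 i) (x t.+1 w ord0 i)) -addrA.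
  apply: le_trans (ler_normD _ _) _; rewrite lerD2r.
  apply: alg_x_bound => k /andP[k1 _].
  by apply: enorm_rate_le1 => //; exact: gw.
have ig t i : (1 <= t)%N -> P.-integrable setT (EFin \o (fun w => g t w ord0 i)).
  by move=> t1; have [] := condg t t1 i.
have igr t i : (1 <= t)%N -> P.-integrable setT (EFin \o (fun w => gr t w ord0 i)).
  by move=> t1; have [_ []] := condg t t1 i.
(* Preimages under [Z t i] are preimages under a coordinate of x_t, hence generators of F_t, and on
   these g_t and grad F(x_t) have equal integrals. *)
have exch t i : (1 <= t)%N ->
    \int[P]_w (gr t w ord0 i * Z t i w) = \int[P]_w (g t w ord0 i * Z t i w).
  move=> t1; apply: (Rintegral_mul_comp_eq _ _ _ _ (M t i)) => //.
  - exact: igr.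
  - exact: ig.
  - exact: ZM.
  move=> B mB; have [_ [_ E]] := condg t t1 i; congr fine; apply/esym/E.
  apply: sub_sigma_algebra.
  exists i, ((fun r => r - xstar ord0 i) @^-1` B); split.
    rewrite -[X in measurable X]setTI.
    by have : measurable_fun setT (fun r : R => r - xstar ord0 i); [exact: measurable_funB | apply].
  by left; exists t; rewrite t1 leqnn.
have igZ t i : (1 <= t)%N -> P.-integrable setT (EFin \o ((fun w => g t w ord0 i) \* Z t i)).
  by move=> t1; apply: integrable_mul_ae_bounded (ig _ _ t1) (mZ t i) (ZM t i t1).
have igrZ t i : (1 <= t)%N -> P.-integrable setT (EFin \o ((fun w => gr t w ord0 i) \* Z t i)).
  by move=> t1; apply: integrable_mul_ae_bounded (igr _ _ t1) (mZ t i) (ZM t i t1).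
(* This is G / T^(1 - alpha), the rate in the final bound. *)
pose c := (T%:R * eta T)^-1.
have c0 : 0 <= c by rewrite invr_ge0 mulr_ge0// ltW// rate_gt0.
pose B := 1 + S * D * (2 * ln (1 + 2 * D) + 9 * S).
(* Weighted linearized regret along [h], indexed by [t.+1] so that integrability is available for
   every value of the summation index. *)
pose V (h : nat -> Omega -> 'rV[R]_d) w :=
  \sum_(0 <= t < T) \sum_(i < d) eta t.+1 * (h t.+1 w ord0 i * Z t.+1 i w).
have VE (h : nat -> Omega -> 'rV[R]_d) w : V h w = \sum_(1 <= t < T.+1) eta t * dotp (h t w) (x t w - xstar).
  rewrite big_add1; apply: eq_bigr => t _; rewrite -mulr_sumr; congr (_ * _).
  by apply: eq_bigr => i _; rewrite !mxE.
have iV (h : nat -> Omega -> 'rV[R]_d) :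
    (forall t i, P.-integrable setT (EFin \o ((fun w => h t.+1 w ord0 i) \* Z t.+1 i))) ->
    P.-integrable setT (EFin \o V h) /\
    \int[P]_w V h w = \sum_(0 <= t < T) \sum_(i < d)
      eta t.+1 * \int[P]_w (h t.+1 w ord0 i * Z t.+1 i w).
  move=> ih.
  have ih' t i : P.-integrable setT
      (EFin \o (fun w => eta t.+1 * (h t.+1 w ord0 i * Z t.+1 i w))).
    exact: (integrableZl measurableT _ (ih t i)).
  split; first by do 2 (apply: integrable_sumR => ?).
  rewrite Rintegral_sum => [|t]; last exact: integrable_sumR.
  apply: eq_bigr => t _; rewrite Rintegral_sum//.
  by apply: eq_bigr => i _; rewrite RintegralZl//; exact: ih.
have [igrV grV] := iV gr (fun t i => igrZ t.+1 i isT).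
have [igV gV] := iV g (fun t i => igZ t.+1 i isT).
have VV : \int[P]_w V gr w = \int[P]_w V g w.
  by rewrite grV gV; do 2 (apply: eq_bigr => ? _); rewrite exch.
have VB : (\int[P]_w (V g w)%:E <= B%:E)%E.
  apply: integral_le_ae_cst; first exact/measurable_EFinP/(measurable_int P).
  apply: filterS gGall => w gw; rewrite VE.
  by apply: regret_bound => // t /andP[t1 _]; exact: gw.
have icst : P.-integrable setT (EFin \o cst (F xstar)).
  exact: finite_measure_integrable_cst.
apply: (@le_trans _ _ (\int[P]_w (F xstar + c * V gr w)%:E)%E).
  apply: integral_mono => w; rewrite lee_fin VE.
  exact: average_suboptimality_le.
rewrite (_ : (fun w => _) = (fun w => (cst (F xstar) w)%:E + (c * V gr w)%:E)%E)//.
rewrite integralD//; last exact: (integrableZl measurableT _ igrV).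
rewrite -[X in (X + _ <= _)%E]/(\int[P]_w cst (F xstar)%:E w)%E integral_cst//.
rewrite [X in (_ * X)%E](_ : _ = 1%E) ?mule1; last exact: probability_setT.
under eq_integral do rewrite EFinM.
rewrite integralZl// -[X in (_ + _ * X)%E]fineK; last exact: integrable_fin_num.
(* In expectation the true gradients now give way to the g_t, whose regret is bounded by [B]. *)
rewrite [fine _]VV fineK; last exact: integrable_fin_num.
rewrite EFinD leeD2l//.
have -> : G / T%:R `^ (1 - alpha) = c.
  have T0 : 0 < T%:R :> R by rewrite ltr0n.
  rewrite /c /eta powRB ?(gt_eqF T0) ?implybT// powRr1 ?(ltW T0)//.
  by have := powR_gt0 alpha T0 => Ta; field; rewrite !gt_eqF.
by rewrite EFinM; apply: lee_wpmul2l.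
Qed.
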